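(* Given a model $\mathbb{M}=(\mathbb{P}_n,f)$ with $m$ signals, consider any $(\alpha,\beta)$-controlled top-$K$ procedure such that $2\max\{\alpha,\beta\}<\tfrac13$. Then for any scalar $\epsilon\in\big(2\max\{\alpha,\beta\},\tfrac13\big)$, there exists a constant $c_0=c_0(\epsilon)\ge1$ (a function of $\epsilon$) such that $$\alpha\ \ge\ c_0^{-1}\,\mathrm{FDP}_-^*(\beta,\epsilon)\quad\text{and}\quad \max\{\alpha,\beta\}\ \ge\ c_0^{-1}\,\mathrm{FNP}_-^*(\beta,\epsilon),$$ as well as $$\beta\ \ge\ c_0^{-1}\,\mathrm{FNP}_+^*(\alpha,\epsilon)\quad\text{and}\quad \max\{\alpha,\beta\}\ \ge\ c_0^{-1}\,\mathrm{FDP}_+^*(\alpha,\epsilon).$$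
   Context: Setting. $[n]=\{1,\dots,n\}$ is partitioned into a set $\mathcal{H}_0$ of nulls and a set $\mathcal{H}_1$ of signals, with $m=\mathrm{card}(\mathcal{H}_1)$. A model is a pair $\mathbb{M}=(\mathbb{P}_n,f)$, where $\mathbb{P}_n$ is a probability distribution on $\mathbb{R}^n$ (not necessarily a product) with atom-free marginals, and $f:\mathbb{R}\to\mathbb{R}$ is non-decreasing with $f(w)\ge w$ for all $w$ in the support of a marginal of $\mathbb{P}_n$. With $W=(W_1,\dots,W_n)\sim\mathbb{P}_n$, the observed test statistics are $X_i=W_i$ for $i\in\mathcal{H}_0$ and $X_i=f(W_i)$ for $i\in\mathcal{H}_1$. Subscript $(k)$ denotes the $k$-th largest value: $X_{(k)}$ among $X_1,\dots,X_n$, and $W_{\mathcal{H}_j,(k)}$ among $(W_i)_{i\in\mathcal{H}_j}$, $j=0,1$. A top-$K$ procedure rejects the hypotheses corresponding to the top $K$ statistics, where $K=K_n(X_1,\dots,X_n)$ is a (possibly randomized) non-negative integer that may depend on the observed statistics; its discovery set is $\mathcal{I}=\{i\in[n]:X_i\ge X_{(K)}\}$. Define $$\mathrm{FDR}=\mathbb{E}\Big[\frac{\mathrm{card}(\mathcal{I}\cap\mathcal{H}_0)}{\max\{\mathrm{card}(\mathcal{I}),1\}}\Big],\qquad \mathrm{FNR}=\mathbb{E}\Big[\frac{\mathrm{card}(\mathcal{I}^c\cap\mathcal{H}_1)}{\mathrm{card}(\mathcal{H}_1)}\Big].$$ For a pair $(\alpha,\beta)\in[0,1]\times[0,1]$,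 a top-$K$ procedure is $(\alpha,\beta)$-controlled if $\mathrm{FDR}\le\alpha$ and $\mathrm{FNR}\le\beta$. Proxies. For $\epsilon>\max\{\alpha,\beta\}$ let $$k_-^*=k_-^*(\beta,\epsilon)=\Big(1-\frac{\beta}{\epsilon}\Big)m,\qquad k_+^*=k_+^*(\alpha,\epsilon)=\Big(1-\frac{\alpha}{\epsilon}\Big)^{-1}m,$$ which are treated as integers. Let $$\ell_-^*(\beta,\epsilon,\mathbb{M})=\arg\max_{\ell\in[1,k_-^*]}\Big\{\mathbb{P}\big[W_{\mathcal{H}_0,(\ell)}>f(W_{\mathcal{H}_1,(k_-^*-\ell+1)})\big]\ge1-\epsilon\Big\},$$ $$\ell_+^*(\alpha,\epsilon,\mathbb{M})=\arg\max_{\ell\in[k_+^*-m,\,k_+^*]}\Big\{\mathbb{P}\big[W_{\mathcal{H}_0,(\ell)}>f(W_{\mathcal{H}_1,(k_+^*-\ell+1)})\big]\ge1-\epsilon\Big\},$$ that is, the largest $\ell$ in the indicated range for which the probability inequality holds. Finally (suppressing $\mathbb{M}$ in the notation) $$\mathrm{FDP}_-^*(\beta,\epsilon)=\frac{\ell_-^*}{m},\quad \mathrm{FNP}_-^*(\beta,\epsilon)=\frac{m-k_-^*+\ell_-^*}{m},\quad \mathrm{FDP}_+^*(\alpha,\epsilon)=\frac{\ell_+^*}{m},\quad \mathrm{FNP}_+^*(\alpha,\epsilon)=\frac{m-k_+^*+\ell_+^*}{m}.$$ *)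

(* Defs.v *)
From HB Require Import structures.
From mathcomp Require Import all_boot all_order all_algebra.
From mathcomp Require Import all_classical all_reals all_analysis.
Set Implicit Arguments.
Unset Strict Implicit.
Unset Printing Implicit Defensive.
Import Order.TTheory GRing.Theory Num.Theory numFieldNormedType.Exports.
Local Open Scope classical_set_scope.
Local Open Scope ring_scope.

Section OrderStatistics.
Context {R : realType}.

(* The k-th largest entry of s, counted from 1. The value is extended by +oo
   at k = 0 and by -oo for k > size s, so that {x in s | x >= x_(k)} is empty
   in the first case and all of s in the second. *)
Definition kth_largest (s : seq R) (k : nat) : \bar R :=
  if k is k'.+1 then nth -oo%E [seq x%:E | x <- sort >=%R s] k' else +oo%E.

Definition order_stat n (w : n.-tuple R) (A : {set 'I_n}) (k : nat) : \bar R :=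
  kth_largest [seq tnth w i | i in A] k.

End OrderStatistics.

Section Model.
Context (R : realType) (n : nat).

(* The value at B of the law of the i-th coordinate. *)
Definition marginal (P : probability (n.-tuple R) R) (i : 'I_n) (B : set R) :
  \bar R := P [set w | B (tnth w i)].

Definition marginal_support (P : probability (n.-tuple R) R) (i : 'I_n) :
  set R := [set x | forall B, open B -> B x -> (0 < marginal P i B)%E].

Record model := Model {
  law : probability (n.-tuple R) R;
  shift : R -> R;
  law_atom_free : forall (i : 'I_n) (x : R), marginal law i [set x] = 0%E;
  shift_mono : {homo shift : x y / x <= y};
  shift_ge : forall (i : 'I_n) (x : R), marginal_support law i x -> x <= shift x
}.

(* The number of rejections is a measurable function of the test statistics
   and of a seed in U, drawn from seed_law independently of the data. *)
Record topK_procedure (d : measure_display) (U : measurableType d) :=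
  TopKProcedure {
    seed_law : probability U R;
    top_count : n.-tuple R * U -> nat;
    measurable_top_count : measurable_fun [set: n.-tuple R * U] top_count
  }.

End Model.

Section ErrorRates.
Context {R : realType} {n : nat} (H1 : {set 'I_n}).
Let H0 : {set 'I_n} := ~: H1.

Definition test_stats (f : R -> R) (w : n.-tuple R) : n.-tuple R :=
  [tuple if i \in H1 then f (tnth w i) else tnth w i | i < n].

Definition discoveries (x : n.-tuple R) (k : nat) : {set 'I_n} :=
  [set i | (kth_largest x k <= (tnth x i)%:E)%E].

Definition false_discovery_prop (I : {set 'I_n}) : R :=
  #|I :&: H0|%:R / (maxn #|I| 1)%:R.

Definition false_nondiscovery_prop (I : {set 'I_n}) : R :=
  #|~: I :&: H1|%:R / #|H1|%:R.

Context (M : model R n) {d : measure_display} {U : measurableType d}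
  (T : topK_procedure R n U).

Definition discovery_set (wu : n.-tuple R * U) : {set 'I_n} :=
  let x := test_stats (shift M) wu.1 in discoveries x (top_count T (x, wu.2)).

Definition FDR : \bar R :=
  ('E_(law M \x seed_law T) [false_discovery_prop \o discovery_set])%E.

Definition FNR : \bar R :=
  ('E_(law M \x seed_law T) [false_nondiscovery_prop \o discovery_set])%E.

Definition controlled (alpha beta : R) : Prop :=
  (FDR <= alpha%:E)%E /\ (FNR <= beta%:E)%E.

End ErrorRates.

Section Proxies.
Context {R : realType} {n : nat} (H1 : {set 'I_n}).
Let H0 : {set 'I_n} := ~: H1.
Let m : nat := #|H1|.

(* When (1 - beta / eps) m or (1 - alpha / eps)^-1 m is not an integer, the
   first is rounded up and the second down: these are the least number of true
   discoveries compatible with a false nondiscovery proportion at most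
   beta / eps, and the largest number of discoveries compatible with a false
   discovery proportion at most alpha / eps. *)
Definition k_minus (beta eps : R) : nat :=
  `|Num.ceil ((1 - beta / eps) * m%:R)|%N.

Definition k_plus (alpha eps : R) : nat :=
  `|Num.floor ((1 - alpha / eps)^-1 * m%:R)|%N.

Context (M : model R n).

(* W_(H0,(l)) > f (W_(H1,(k - l + 1))), with f (-oo) = -oo. For k = k_plus and
   l = k - m the index on the right is m + 1, so the right-hand side is -oo. *)
Definition null_above_signal (k l : nat) : set (n.-tuple R) :=
  [set w | (er_map (shift M) (order_stat w H1 (k - l).+1)
            < order_stat w H0 l)%E].

Definition likely (eps : R) (k l : nat) : bool :=
  ((1 - eps)%:E <= law M (null_above_signal k l))%E.

(* The maximum over an empty set of l is 0. *)
Definition ell_minus (beta eps : R) : nat :=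
  let k := k_minus beta eps in
  \max_(1 <= l < k.+1 | likely eps k l) l.

(* If k <= n then l = k - m always qualifies, because its event is certain;
   otherwise the set may be empty, and k - m is taken as the maximum. *)
Definition ell_plus (alpha eps : R) : nat :=
  let k := k_plus alpha eps in
  maxn (k - m) (\max_(k - m <= l < k.+1 | likely eps k l) l).

Definition FDP_minus (beta eps : R) : R := (ell_minus beta eps)%:R / m%:R.

Definition FNP_minus (beta eps : R) : R :=
  (m%:R - (k_minus beta eps)%:R + (ell_minus beta eps)%:R) / m%:R.

Definition FDP_plus (alpha eps : R) : R := (ell_plus alpha eps)%:R / m%:R.

Definition FNP_plus (alpha eps : R) : R :=
  (m%:R - (k_plus alpha eps)%:R + (ell_plus alpha eps)%:R) / m%:R.

End Proxies.

(* Main.v *)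
(* Suppose more than k - l signals are discovered while the l-th largest null
   exceeds the (k - l + 1)-th largest signal. A discovery set is upward closed,
   so it then contains l nulls. For k = k_minus, Markov's inequality applied to
   FNR gives at least k true discoveries with probability 1 - eps; on the
   ordering event for l = ell_minus this forces l false discoveries out of at
   most l + m, so FDR >= (1 - 2 eps) l / 2 m. For k = k_plus, Markov's
   inequality applied to FDR gives at most k discoveries, so at most k - l of
   them are signals and FNR >= (1 - 2 eps) (m - k + l) / m. *)
Require Import Defs.
From HB Require Import structures.
From mathcomp Require Import all_boot all_order all_algebra.
From mathcomp Require Import all_classical all_reals all_analysis.
From mathcomp Require Import measurable_realfun.
From mathcomp Require Import lra zify.
Set Implicit Arguments.
Unset Strict Implicit.
Unset Printing Implicit Defensive.
Import Order.TTheory GRing.Theory Num.Theory numFieldNormedType.Exports.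
Local Open Scope classical_set_scope.
Local Open Scope ring_scope.

(** * Order statistics as counts of larger entries *)

Lemma count_image (I : finType) (T : Type) (p : pred T) (A : {pred I}) (f : I -> T) :
  count p [seq f i | i in A] = #|[set i in A | p (f i)]%SET|.
Proof.
rewrite count_map -size_filter cardE -filter_predI.
congr size; apply: eq_filter => y.
by rewrite !inE andbC.
Qed.

Section KthLargest.
Context {R : realType}.
Implicit Types (s : seq R) (t : R) (k : nat).

(** In a decreasing list, once the head is at most [t], no later entry exceeds [t], so induction
    along the sorted list suffices. The conventions +oo at [k = 0] and -oo past the end make the
    equivalence hold for every [k]. *)
Lemma lt_kth_largest s k t :
  (t%:E < kth_largest s k)%E = (k <= count (fun x => (t < x)%R) s)%N.
Proof.
case: k => [|k]; first by rewrite /= ltry.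
rewrite /kth_largest.
have /permP <- : perm_eq (sort >=%R s) s by rewrite perm_sort.
have : sorted >=%R (sort >=%R s) by apply: sort_sorted => x y; exact: le_total.
elim: (sort _ s) k => [|x r IHr] k /=; first by rewrite nth_nil.
move=> pxr; have /allP xmax := order_path_min ge_trans pxr.
have {}IHr := IHr _ (path_sorted pxr).
have [tx|xt] /= := ltP t x.
  by case: k => [|k] /=; rewrite ?lte_fin ?tx // IHr.
have c0 : count (fun y => t < y) r = 0%N.
  apply/eqP; rewrite -leqn0 leqNgt -has_count; apply/hasPn => y /xmax yx.
  by rewrite -leNgt (le_trans yx).
by case: k => [|k] /=; rewrite ?lte_fin ?IHr c0 // ltNge xt.
Qed.

Lemma kth_largest_mem s k : (0 < k <= size s)%N ->
  exists2 x, x \in s & kth_largest s k = x%:E.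
Proof.
case: k => // k /= ks; exists (nth 0 (sort >=%R s) k).
  by rewrite -(mem_sort >=%R) mem_nth ?size_sort.
by rewrite (nth_map 0) ?size_sort.
Qed.

End KthLargest.

(** * Discovery sets and the ordering event *)

Section Discoveries.
Context {R : realType} {n : nat}.
Implicit Types (x w : n.-tuple R) (A : {set 'I_n}) (k l : nat).

Lemma count_tuple (T : Type) (p : pred T) (x : n.-tuple T) :
  count p x = #|[set i | p (tnth x i)]%SET|.
Proof.
rewrite -[tval x]map_tnth_enum count_image.
by apply: eq_card => i; rewrite !inE.
Qed.

Lemma lt_order_stat w A k (t : R) :
  (t%:E < order_stat w A k)%E = (k <= #|[set i in A | (t < tnth w i)%R]%SET|)%N.
Proof. by rewrite /order_stat lt_kth_largest count_image. Qed.

Lemma mem_discoveries x k i :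
  (i \in discoveries x k) = (#|[set j | (tnth x i < tnth x j)%R]%SET| < k)%N.
Proof. by rewrite inE leNgt lt_kth_largest -ltnNge count_tuple. Qed.

Lemma discoveries_up x k i j :
  i \in discoveries x k -> tnth x i <= tnth x j -> j \in discoveries x k.
Proof. by rewrite !inE => ki xij; rewrite (le_trans ki) ?lee_fin. Qed.

(** The bound on [k - l] makes the signal order statistic a genuine entry, whose index is the
    witness [i]. Conversely, an [i] with at most [k - l] signals strictly above it lies at or above
    that order statistic, and monotonicity of the shift carries the bound on the nulls down to
    it. *)
Lemma null_above_signalP (H1 : {set 'I_n}) (M : model R n) k l w :
  (k - l < #|H1|)%N ->
  null_above_signal H1 M k l w <->
  [exists i in H1, (#|[set j in H1 | (tnth w i < tnth w j)%R]%SET| <= k - l)%N &&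
     (l <= #|[set j in ~: H1 | (Defs.shift M (tnth w i) < tnth w j)%R]%SET|)%N].
Proof.
move=> klm; have : (0 < (k - l).+1 <= size [seq tnth w i | i in H1])%N.
  by rewrite size_image.
case/kth_largest_mem => x /mapP[i]; rewrite mem_enum => iH -> wi.
rewrite /null_above_signal /mkset {1}/order_stat wi lt_order_stat.
split=> [lH0|/exists_inP[j jH /andP[jkl]]].
  apply/exists_inP; exists i => //; rewrite lH0 andbT leqNgt -lt_order_stat.
  by rewrite /order_stat wi ltxx.
move=> /leq_trans; apply; apply/subset_leq_card/fintype.subsetP => i'.
rewrite !inE => /andP[-> /=]; apply: le_lt_trans; apply: shift_mono.
by move: jkl; rewrite leqNgt -lt_order_stat /order_stat wi lte_fin -leNgt.
Qed.

(* Of the more than k - l discovered signals, one is no larger than the signal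
   lying below l nulls, so that these nulls are discovered as well. *)
Lemma null_discoveries (H1 : {set 'I_n}) (M : model R n) k l w K :
  (k - l < #|H1|)%N ->
  null_above_signal H1 M k l w ->
  let I := discoveries (test_stats H1 (Defs.shift M) w) K in
  (k - l < #|I :&: H1|)%N -> (l <= #|I :&: ~: H1|)%N.
Proof.
move=> klm /(null_above_signalP _ _ klm)/exists_inP[i iH /andP[ikl li]] I klI.
have [i' i'I Ni'] : exists2 i', i' \in I :&: H1 & tnth w i' <= tnth w i.
  apply/exists_inP; apply: contraLR (leq_ltn_trans ikl klI).
  rewrite -leqNgt => /exists_inPn H; apply/subset_leq_card/fintype.subsetP => j jI.
  by move: (H j jI); rewrite -ltNge !inE => ->; move: jI; rewrite inE => /andP[_ ->].
move: i'I; rewrite inE => /andP[i'I i'H].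
apply: (leq_trans li); apply/subset_leq_card/fintype.subsetP => j.
rewrite inE [_ \in ~: _]inE => /andP[jH ij].
rewrite finset.in_setI [X in _ && X]inE jH andbT.
apply: discoveries_up i'I _; rewrite !tnth_mktuple i'H (negbTE jH).
by apply: le_trans (ltW ij); apply: shift_mono.
Qed.

End Discoveries.

(** * Measurability of the events and error proportions *)

Section Measurability.

(** There are finitely many values [S] of [D], and each event [D x = S] is a finite intersection of
    membership events or their complements. *)
Lemma measurable_finset_comp d d' (T : measurableType d) (T' : measurableType d')
    (I : finType) (D : T -> {set I}) (phi : {set I} -> T') :
  (forall i, measurable_fun [set: T] (fun x => i \in D x)) ->
  measurable_fun [set: T] (phi \o D).
Proof.
move=> mD _ Y mY; rewrite setTI.
have -> : (phi \o D) @^-1` Y =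
    \bigcup_(S in [set S | Y (phi S)]) \bigcap_(i in [set: I])
      (fun x => i \in D x) @^-1` [set i \in S].
  apply/seteqP; split=> x /=.
    by move=> Yx; exists (D x).
  by case=> S YS DS; suff -> : D x = S by []; apply/finset.setP => i; exact: DS.
apply: fin_bigcup_measurable => [|S _]; first exact: finite_finset.
apply: fin_bigcap_measurable => [|i _]; first exact: finite_finset.
by rewrite -[X in measurable X]setTI; exact: mD.
Qed.

Context {R : realType} {n : nat}.

Lemma measurable_test_stats (H1 : {set 'I_n}) (M : model R n) :
  measurable_fun [set: n.-tuple R] (test_stats H1 (Defs.shift M)).
Proof.
apply/measurable_fun_tnthP => i; rewrite (_ : _ \o _ = fun w =>
    if i \in H1 then Defs.shift M (tnth w i) else tnth w i); last first.
  by apply/funext => w /=; rewrite tnth_mktuple.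
case: (i \in H1); last exact: measurable_tnth.
apply: measurableT_comp; last exact: measurable_tnth.
by apply: nondecreasing_measurable => //; exact: shift_mono.
Qed.

Lemma measurable_null_above_signal (H1 : {set 'I_n}) (M : model R n) k l :
  (k - l < #|H1|)%N -> measurable (null_above_signal H1 M k l).
Proof.
move=> klm.
have mcard (A : {set 'I_n}) (f : R -> R) i : {homo f : x y / x <= y} ->
    measurable_fun [set: n.-tuple R]
      (fun w => #|[set j in A | (f (tnth w i) < tnth w j)%R]%SET|).
  move=> fmono; apply: (measurable_finset_comp
    (D := fun w : n.-tuple R => [set j in A | (f (tnth w i) < tnth w j)%R]%SET)
    (fun S => #|S|)) => j.
  under eq_fun do rewrite inE.
  apply: measurable_and; first exact: measurable_cst.
  apply: measurable_fun_ltr; last exact: measurable_tnth.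
  apply: measurableT_comp; last exact: measurable_tnth.
  by apply: nondecreasing_measurable => //; exact: fmono.
(* The existential over signals becomes a finite union of events about counts; [mcard] serves both
   counts, with the identity and with the shift. *)
have -> : null_above_signal H1 M k l = \bigcup_(i in [set i | i \in H1])
    ([set w | (#|[set j in H1 | (tnth w i < tnth w j)%R]%SET| <= k - l)%N] `&`
     [set w | (l <= #|[set j in ~: H1 |
                       (Defs.shift M (tnth w i) < tnth w j)%R]%SET|)%N]).
  apply/seteqP; split=> w /=.
    by move=> /(null_above_signalP _ _ klm)/exists_inP[i iH /andP[? ?]]; exists i.
  case=> i iH /= [? ?]; apply/(null_above_signalP _ _ klm)/exists_inP.
  by exists i => //; apply/andP.
apply: fin_bigcup_measurable => [|i _]; first exact: finite_finset.
apply: measurableI.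
  rewrite -[X in measurable X]setTI.
  exact: (mcard H1 id i _ measurableT [set c | (c <= k - l)%N]).
rewrite -[X in measurable X]setTI.
exact: (mcard (~: H1) (Defs.shift M) i (@shift_mono _ _ M) measurableT
  [set c | (l <= c)%N]).
Qed.

Lemma measurable_discovery_set (H1 : {set 'I_n}) (M : model R n)
    d (U : measurableType d) (T : topK_procedure R n U) (phi : {set 'I_n} -> R) :
  measurable_fun [set: n.-tuple R * U] (phi \o discovery_set H1 M T).
Proof.
have mX : measurable_fun [set: n.-tuple R * U]
    (fun wu => test_stats H1 (Defs.shift M) wu.1).
  exact: measurableT_comp (measurable_test_stats _ _) measurable_fst.
apply: measurable_finset_comp => i.
under eq_fun do rewrite /discovery_set mem_discoveries.
apply: measurable_fun_ltn.
  apply: (measurable_finset_comp (D := fun wu : n.-tuple R * U =>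
    [set j | (tnth (test_stats H1 (Defs.shift M) wu.1) i <
             tnth (test_stats H1 (Defs.shift M) wu.1) j)%R]%SET)
    (fun S => #|S|)) => j.
  under eq_fun do rewrite inE.
  by apply: measurable_fun_ltr; exact: measurableT_comp (measurable_tnth _) mX.
apply: measurableT_comp (measurable_top_count T) _.
by apply: measurable_fun_pair => //; exact: measurable_snd.
Qed.

End Measurability.

(** * Lower bounds on expectations from likely events *)

Section LikelyEvents.
Context d (T : measurableType d) (R : realType) (P : probability T R).

Lemma expectation_ge_on (g : T -> R) (A : set T) (c : R) :
  measurable_fun [set: T] g -> (forall x, 0 <= g x) -> measurable A -> 0 <= c ->
  (forall x, A x -> c <= g x) -> (c%:E * P A <= 'E_P[g])%E.
Proof.
move=> mg g0 mA c0 cg; rewrite unlock -integral_cst//.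
have mEg : measurable_fun [set: T] (EFin \o g) by exact/measurable_EFinP.
apply: (@le_trans _ _ (\int[P]_(x in A) (g x)%:E)%E).
  by apply: ge0_le_integral => //; exact: measurable_funS mEg.
by apply: ge0_subset_integral => // x _; rewrite lee_fin.
Qed.

Lemma markov_gt (h : T -> R) (b eps : R) :
  measurable_fun [set: T] h -> (forall x, 0 <= h x) -> 0 <= b -> 0 < eps ->
  ('E_P[h] <= b%:E)%E -> (P [set x | b / eps < h x]%R <= eps%:E)%E.
Proof.
move=> mh h0 b0 e0 Eh.
have mA : measurable [set x | b / eps < h x].
  by rewrite -[X in measurable X]setTI -preimage_itvoy; exact: mh.
move: b0; rewrite le_eqVlt => /orP[/eqP b0|b0]; last first.
  have := le_trans (expectation_ge_on mh h0 mA (ltW (divr_gt0 b0 e0))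
    (fun x => @ltW _ _ _ _)) Eh.
  rewrite -[P _]fineK ?fin_num_measure// -EFinM !lee_fin => le_b.
  by rewrite -(ler_pM2l b0) -ler_pdivrMr// mulrAC.
(* For [b = 0] one cannot divide by [b]. The event is then [0 < h], and a zero expectation forces
   [h] to vanish almost everywhere. *)
have mEh : measurable_fun [set: T] (EFin \o h) by exact/measurable_EFinP.
have [N [mN PN hN]] : ae_eq P [set: T] (EFin \o h) (cst 0%E).
  apply/(ae_eq_integral_abs P measurableT mEh)/eqP.
  rewrite eq_le integral_ge0//= andbT;
  rewrite -b0 in Eh; apply: le_trans Eh; rewrite unlock le_eqVlt; apply/orP; left.
  by apply/eqP/eq_integral => x _ /=; rewrite ger0_norm.
apply: (@le_trans _ _ (P N)); last by rewrite PN lee_fin ltW.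
apply: le_measure; rewrite ?inE// => x /= hx; apply: hN => /(_ I)[] hx0.
by move: hx; rewrite hx0 -b0 mul0r ltxx.
Qed.

(** Removing from [A] the Markov event [b / eps < h] costs at most [eps], so [g] is at least [c]
    with probability at least [1 - 2 * eps]. Used twice, with the two error proportions as [g] and
    [h] in either order. *)
Lemma expectation_ge_likely (g h : T -> R) (A : set T) (b c eps : R) :
  measurable_fun [set: T] g -> measurable_fun [set: T] h ->
  (forall x, 0 <= g x) -> (forall x, 0 <= h x) -> 0 <= b -> 0 <= c -> 0 < eps ->
  ('E_P[h] <= b%:E)%E -> measurable A -> ((1 - eps)%:E <= P A)%E ->
  (forall x, A x -> h x <= b / eps -> c <= g x) ->
  ((c * (1 - 2 * eps))%:E <= 'E_P[g])%E.
Proof.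
move=> mg mh g0 h0 b0 c0 e0 Eh mA PA cg.
have mB : measurable [set x | b / eps < h x].
  by rewrite -[X in measurable X]setTI -preimage_itvoy; exact: mh.
have mAB := measurableD mA mB.
have cgAB x : (A `\` [set x | b / eps < h x]) x -> c <= g x.
  by case=> Ax /negP; rewrite -leNgt; exact: cg.
apply: le_trans (expectation_ge_on mg g0 mAB c0 cgAB).
rewrite EFinM lee_wpmul2l ?lee_fin//.
have := markov_gt mh h0 b0 e0 Eh.
have : (P A <= P (A `\` [set x | b / eps < h x]%R) + P [set x | b / eps < h x]%R)%E.
  apply: le_trans (measureU2 P mAB mB).
  apply: le_measure; rewrite ?inE//; first exact: measurableU.
  move=> x Ax /=; have [?|?] := ltP (b / eps) (h x); first by right.
  by left; split=> //; apply/negP; rewrite -leNgt.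
move: PA.
have /fineK <- := fin_num_measure P _ mA.
have /fineK <- := fin_num_measure P _ mB.
have /fineK <- := fin_num_measure P _ mAB.
rewrite -EFinD !lee_fin; lra.
Qed.

End LikelyEvents.

(** * Lower bounds on FDR and FNR *)

Section ErrorBounds.
Context {R : realType} {n : nat} (H1 : {set 'I_n}) (M : model R n).
Context {d : measure_display} {U : measurableType d} (T : topK_procedure R n U).
Local Notation m := #|H1|.

Lemma card_discoveries (I : {set 'I_n}) :
  #|I| = (#|I :&: H1| + #|I :&: ~: H1|)%N.
Proof. by rewrite -finset.setDE cardsID. Qed.

Lemma card_nondiscoveries (I : {set 'I_n}) :
  (#|I :&: H1| + #|~: I :&: H1|)%N = m.
Proof.
by rewrite finset.setIC [~: I :&: _]finset.setIC -finset.setDE cardsID.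
Qed.

Lemma false_discovery_prop_ge0 (I : {set 'I_n}) :
  0 <= false_discovery_prop H1 I :> R.
Proof. by rewrite divr_ge0. Qed.

Lemma false_nondiscovery_prop_ge0 (I : {set 'I_n}) :
  0 <= false_nondiscovery_prop H1 I :> R.
Proof. by rewrite divr_ge0. Qed.

(** The ordering event ignores the seed, whose law has total mass 1. *)
Lemma null_above_signal_prod k l : (k - l < m)%N ->
  measurable (null_above_signal H1 M k l `*` [set: U]) /\
  (law M \x seed_law T)%E (null_above_signal H1 M k l `*` [set: U]) =
    law M (null_above_signal H1 M k l).
Proof.
move=> klm; have mA := measurable_null_above_signal M klm.
split; first exact: measurableX.
rewrite [LHS]product_measure1E// -[RHS]mule1; congr (_ * _)%E.
exact: probability_setT.
Qed.

(** Rounding enters only through the hypothesis on [t]: a nondiscovery proportion at most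
    [beta / eps] means at least [(1 - beta / eps) * m] true discoveries, hence at least [k]. As [l]
    is positive, this exceeds [k - l], which brings in [l] nulls. *)
Lemma FDR_ge (k l : nat) (beta eps : R) :
  0 <= beta -> 0 < eps -> (0 < l <= k)%N -> (k <= m)%N ->
  (forall t : nat, (1 - beta / eps) * m%:R <= t%:R -> (k <= t)%N) ->
  likely H1 M eps k l -> (FNR H1 M T <= beta%:E)%E ->
  ((l%:R / (2 * m%:R) * (1 - 2 * eps))%:E <= FDR H1 M T)%E.
Proof.
move=> b0 e0 /andP[l0 lk] km kmin lkly FNRb.
have klm : (k - l < m)%N by lia.
have m0 : (0 < m)%N by lia.
have [mA PA] := null_above_signal_prod klm.
apply: (expectation_ge_likely _ _ _ _ b0 _ e0 FNRb mA).
- exact: measurable_discovery_set.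
- exact: measurable_discovery_set.
- by move=> wu; exact: false_discovery_prop_ge0.
- by move=> wu; exact: false_nondiscovery_prop_ge0.
- by rewrite divr_ge0// mulr_ge0.
- by move: lkly; rewrite /likely -PA.
move=> wu [Awu _] /=; rewrite /false_nondiscovery_prop /false_discovery_prop.
rewrite ler_pdivrMr ?ltr0n// => FNPb.
have TDk : (k <= #|discovery_set H1 M T wu :&: H1|)%N.
  apply: kmin; rewrite mulrBl mul1r lerBlDr.
  rewrite -[X in X%:R <= _](card_nondiscoveries (discovery_set H1 M T wu)).
  by rewrite natrD lerD2l.
have FDl : (l <= #|discovery_set H1 M T wu :&: ~: H1|)%N.
  apply: null_discoveries klm Awu _.
  by rewrite (leq_trans _ TDk)// ltn_subrL l0 (leq_trans l0).
rewrite (card_discoveries (discovery_set H1 M T wu)).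
have TDm := card_nondiscoveries (discovery_set H1 M T wu).
move: TDk FDl TDm.
set t := #|_ :&: H1|; set f := #|_ :&: ~: H1|; set u := #|~: _ :&: _| => TDk FDl TDm.
rewrite ler_pdivrMr ?mulr_gt0 ?ltr0n// mulrAC ler_pdivlMr ?ltr0n ?leq_max ?orbT//.
have tf0 : (0 < t + f)%N by rewrite addn_gt0 (leq_trans l0 FDl) orbT.
rewrite -!natrM ler_nat (maxn_idPl tf0).
(* The inequality [l * (t + f) <= f * (2 * m)] splits into [l * t <= f * m], from [l <= f] and
   [t <= m], and [l * f <= f * m], from [l <= k <= m]. *)
rewrite mulnDr mul2n -addnn mulnDr leq_add//.
  by rewrite leq_mul// -TDm leq_addr.
by rewrite mulnC leq_mul// (leq_trans lk).
Qed.

Lemma FNR_ge (k l : nat) (alpha eps : R) :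
  0 <= alpha -> 0 < eps -> (l <= k)%N -> (k < l + m)%N ->
  (forall t : nat, (1 - alpha / eps) * t%:R <= m%:R -> (t <= k)%N) ->
  likely H1 M eps k l -> (FDR H1 M T <= alpha%:E)%E ->
  (((m + l - k)%:R / m%:R * (1 - 2 * eps))%:E <= FNR H1 M T)%E.
Proof.
move=> a0 e0 lk klm' kmax lkly FDRa.
have klm : (k - l < m)%N by lia.
have m0 : (0 < m)%N by lia.
have [mA PA] := null_above_signal_prod klm.
apply: (expectation_ge_likely _ _ _ _ a0 _ e0 FDRa mA).
- exact: measurable_discovery_set.
- exact: measurable_discovery_set.
- by move=> wu; exact: false_nondiscovery_prop_ge0.
- by move=> wu; exact: false_discovery_prop_ge0.
- by rewrite divr_ge0.
- by move: lkly; rewrite /likely -PA.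
move=> wu [Awu _] /=; rewrite /false_nondiscovery_prop /false_discovery_prop.
have TDm := card_nondiscoveries (discovery_set H1 M T wu).
rewrite (card_discoveries (discovery_set H1 M T wu)).
rewrite ler_pdivrMr ?ltr0n ?leq_max ?orbT// => FDPa.
rewrite ler_pM2r ?invr_gt0 ?ltr0n// ler_nat.
have FDl : (k - l < #|discovery_set H1 M T wu :&: H1|)%N ->
    (l <= #|discovery_set H1 M T wu :&: ~: H1|)%N.
  exact: null_discoveries klm Awu.
move: TDm FDPa FDl.
set t := #|_ :&: H1|; set f := #|_ :&: ~: H1|; set u := #|~: _ :&: _|.
move=> TDm FDPa FDl; clearbody t f u.
(* If [t] exceeded [k - l], then [f] would be at least [l] and [t + f] would exceed [k]. So
   [t <= k - l], which leaves at least [m + l - k] signals undiscovered. *)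
suff tfk : (t + f <= k)%N.
  move: (#|H1|) klm TDm => q klm TDm.
  by have [/FDl|] := ltnP (k - l) t; lia.
have [->//|tf0] := posnP (t + f)%N.
(* From [f <= alpha / eps * (t + f)] follows [(1 - alpha / eps) * (t + f) <= t <= m]. *)
apply: kmax; rewrite mulrBl mul1r; move: FDPa; rewrite (maxn_idPl tf0).
have : t%:R <= m%:R :> R by rewrite ler_nat; lia.
rewrite natrD; lra.
Qed.

(** * Attained maxima and rounding in the proxies *)

Lemma bigmax_nat_attained (P : pred nat) a b :
  let l := (\max_(a <= i < b | P i) i)%N in
  l = 0%N \/ (P l /\ (a <= l < b)%N).
Proof.
rewrite /= big_nat_cond.
elim/big_ind: _ => [|x y|i /andP[? ?]]; first by left.
  by case: (leqP x y).
by right.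
Qed.

(** For [beta <= eps] the ceiling is nonnegative, so the absolute value in [k_minus] is a mere
    cast. *)
Lemma k_minusE (beta eps : R) : 0 < eps -> beta <= eps ->
  (k_minus H1 beta eps)%:Z = Num.ceil ((1 - beta / eps) * m%:R).
Proof.
move=> e0 be; apply/gez0_abs; rewrite ceil_ge0 (lt_le_trans (ltrN10 _))//.
by rewrite mulr_ge0// subr_ge0 ler_pdivrMr// mul1r.
Qed.

Lemma k_minusP (beta eps : R) (t : nat) : 0 < eps -> beta <= eps ->
  (1 - beta / eps) * m%:R <= t%:R -> (k_minus H1 beta eps <= t)%N.
Proof. by move=> e0 be le_t; rewrite -lez_nat k_minusE// ceil_le_int. Qed.

Lemma k_minus_ge (beta eps : R) : 0 < eps -> beta <= eps ->
  (1 - beta / eps) * m%:R <= (k_minus H1 beta eps)%:R.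
Proof. by move=> e0 be; rewrite [leRHS]pmulrn k_minusE// ceil_ge. Qed.

Lemma k_plusE (alpha eps : R) : 0 < eps -> alpha < eps ->
  (k_plus H1 alpha eps)%:Z = Num.floor ((1 - alpha / eps)^-1 * m%:R).
Proof.
move=> e0 ae; apply/gez0_abs; rewrite floor_ge0 mulr_ge0// invr_ge0 subr_ge0.
by rewrite ler_pdivrMr// mul1r ltW.
Qed.

Lemma k_plusP (alpha eps : R) (t : nat) : 0 < eps -> alpha < eps ->
  (1 - alpha / eps) * t%:R <= m%:R -> (t <= k_plus H1 alpha eps)%N.
Proof.
move=> e0 ae le_m; rewrite -lez_nat k_plusE// floor_ge_int ler_pdivlMl//.
by rewrite subr_gt0 ltr_pdivrMr// mul1r.
Qed.

Lemma k_plus_le (alpha eps : R) : 0 < eps -> alpha < eps ->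
  (1 - alpha / eps) * (k_plus H1 alpha eps)%:R <= m%:R.
Proof.
move=> e0 ae; rewrite -ler_pdivlMl ?subr_gt0 ?ltr_pdivrMr ?mul1r//.
by rewrite [leLHS]pmulrn k_plusE// floor_le.
Qed.

Lemma k_plus_ge_card (alpha eps : R) : 0 <= alpha -> 0 < eps -> alpha < eps ->
  (m <= k_plus H1 alpha eps)%N.
Proof.
move=> a0 e0 ae; apply: k_plusP => //.
by rewrite ler_piMl// gerBl divr_ge0// ltW.
Qed.

(** * Upper bounds on the four proxies *)

Lemma FDP_minus_le (alpha beta eps : R) : 0 <= alpha -> 0 <= beta ->
  2 * beta < eps < 1 / 3 -> controlled H1 M T alpha beta ->
  FDP_minus H1 M beta eps <= 6 * alpha.
Proof.
move=> a0 b0 /andP[ble e3] ctl; have e0 : 0 < eps by lra.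
rewrite /FDP_minus /ell_minus.
have [->|[lkly /andP[l0 lk]]] := bigmax_nat_attained
    (likely H1 M eps (k_minus H1 beta eps)) 1 (k_minus H1 beta eps).+1.
  by rewrite mul0r mulr_ge0.
move: lkly l0 lk; move: (\max_(_ <= _ < _ | _) _)%N => l lkly l0 lk.
have be : beta <= eps by lra.
have km : (k_minus H1 beta eps <= m)%N.
  by apply: k_minusP => //; rewrite ler_piMl// gerBl divr_ge0// ltW.
have l0k : (0 < l <= k_minus H1 beta eps)%N by rewrite l0.
have kmin t := @k_minusP beta eps t e0 be.
have := le_trans (FDR_ge b0 e0 l0k km kmin lkly ctl.2) ctl.1.
(* Since [eps < 1 / 3], the factor [1 - 2 * eps] exceeds 1/3; with the 2 in [2 * m] this gives the
   constant 6. *)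
rewrite lee_fin invfM mulrCA mulrA => h.
have lm0 : 0 <= l%:R / m%:R :> R by rewrite divr_ge0.
nra.
Qed.

Lemma FNP_minus_le (alpha beta eps : R) : 0 <= alpha -> 0 <= beta ->
  2 * beta < eps < 1 / 3 -> controlled H1 M T alpha beta ->
  FNP_minus H1 M beta eps <= beta / eps + 6 * alpha.
Proof.
move=> a0 b0 bee ctl; have /andP[ble e3] := bee; have e0 : 0 < eps by lra.
rewrite /FNP_minus mulrDl lerD//; last exact: FDP_minus_le.
(* What remains is [(m - k) / m <= beta / eps]. Without signals the quotient is 0, as the inverse of
   0 is 0. *)
have [->|m0] := posnP m; first by rewrite invr0 mulr0 divr_ge0// ltW.
rewrite ler_pdivrMr ?ltr0n// lerBlDr -lerBlDl -{1}[m%:R]mul1r -mulrBl.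
by apply: k_minus_ge => //; lra.
Qed.

(** The value [k - m] is set apart: there the signal index is [m + 1], outside the range of
    [FNR_ge], but [FNP_plus] is 0. Any larger value comes from the maximum and is attained. *)
Lemma ell_plus_cases (alpha eps : R) : (m <= k_plus H1 alpha eps)%N ->
  ell_plus H1 M alpha eps = (k_plus H1 alpha eps - m)%N \/
  [/\ likely H1 M eps (k_plus H1 alpha eps) (ell_plus H1 M alpha eps),
     (k_plus H1 alpha eps < ell_plus H1 M alpha eps + m)%N &
     (ell_plus H1 M alpha eps <= k_plus H1 alpha eps)%N].
Proof.
move=> mk; rewrite /ell_plus; set k := k_plus _ _ _.
set l := (\max_(_ <= _ < _ | _) _)%N.
have [lkm|klm] := leqP l (k - m); first by left.
have [l0|[lkly /andP[_ lk]]] := bigmax_nat_attained (likely H1 M eps k) (k - m) k.+1.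
  by move: klm; rewrite /l l0.
right; split=> //; by rewrite addnC -ltn_subLR.
Qed.

Lemma FNP_plus_le (alpha beta eps : R) : 0 <= alpha -> 0 <= beta ->
  2 * alpha < eps < 1 / 3 -> controlled H1 M T alpha beta ->
  FNP_plus H1 M alpha eps <= 3 * beta.
Proof.
move=> a0 b0 aee ctl; have /andP[ale e3] := aee; have e0 : 0 < eps by lra.
have ae : alpha < eps by lra.
have mk := k_plus_ge_card a0 e0 ae.
rewrite /FNP_plus; have [->|[lkly klm lk]] := ell_plus_cases mk.
  by rewrite natrB// addrA subrK subrr mul0r mulr_ge0.
have kmax t := @k_plusP alpha eps t e0 ae.
have := le_trans (FNR_ge a0 e0 lk klm kmax lkly ctl.1) ctl.2.
rewrite lee_fin natrB ?natrD; last by rewrite addnC ltnW.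
rewrite addrAC => h.
have : 0 <= (m%:R - (k_plus H1 alpha eps)%:R +
             (ell_plus H1 M alpha eps)%:R) / m%:R :> R.
  rewrite divr_ge0// addrAC -natrD subr_ge0 ler_nat addnC; exact: ltnW.
nra.
Qed.

Lemma FDP_plus_le (alpha beta eps : R) : 0 <= alpha -> 0 <= beta ->
  2 * alpha < eps < 1 / 3 -> controlled H1 M T alpha beta ->
  FDP_plus H1 M alpha eps <= 3 * beta + 2 * alpha / eps.
Proof.
move=> a0 b0 aee ctl; have /andP[ale e3] := aee; have e0 : 0 < eps by lra.
have ae : alpha < eps by lra.
have a2 : alpha / eps < 2^-1 by rewrite ltr_pdivrMr//; lra.
have ae0 : 0 <= alpha / eps by rewrite divr_ge0// ltW.
(* The excess [(k - m) / m] is at most [q / (1 - q)] for [q = alpha / eps]. This is at most [2 * q]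
   because [eps > 2 * alpha] gives [q < 1 / 2]. *)
have -> : FDP_plus H1 M alpha eps =
    FNP_plus H1 M alpha eps + ((k_plus H1 alpha eps)%:R - m%:R) / m%:R.
  by rewrite -mulrDl; congr (_ / _); lra.
apply: lerD; first exact: FNP_plus_le aee ctl.
have [->|m0] := posnP m; first by rewrite invr0 mulr0 divr_ge0 ?mulr_ge0// ltW.
have {}m0 : 0 < m%:R :> R by rewrite ltr0n.
rewrite ler_pdivrMr//.
have := k_plus_le e0 ae.
have : m%:R <= (k_plus H1 alpha eps)%:R :> R by rewrite ler_nat k_plus_ge_card.
rewrite -mulrA; move: (alpha / eps) a2 ae0 => q q2 q0 h1 h2.
nra.
Qed.

End ErrorBounds.

Theorem theorem1 (R : realType) :
  exists c0 : R -> R,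
    forall (n : nat) (H1 : {set 'I_n}) (M : model R n)
           (d : measure_display) (U : measurableType d)
           (T : topK_procedure R n U) (alpha beta : R),
      0 <= alpha <= 1 -> 0 <= beta <= 1 ->
      controlled H1 M T alpha beta ->
      2 * Num.max alpha beta < 1 / 3 ->
      forall eps : R, 2 * Num.max alpha beta < eps < 1 / 3 ->
        [/\ 1 <= c0 eps,
            alpha >= (c0 eps)^-1 * FDP_minus H1 M beta eps
            /\ Num.max alpha beta >= (c0 eps)^-1 * FNP_minus H1 M beta eps
          & beta >= (c0 eps)^-1 * FNP_plus H1 M alpha eps
            /\ Num.max alpha beta >= (c0 eps)^-1 * FDP_plus H1 M alpha eps].
Proof.
(* This dominates the total coefficient in each of the bounds [6 * alpha], [beta / eps + 6 * alpha],
   [3 * beta] and [3 * beta + 2 * alpha / eps], once [alpha] and [beta] are replaced by their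
   maximum in the second and fourth. *)
exists (fun eps => 6 + 2 / eps).
move=> n H1 M d U T alpha beta /andP[a0 _] /andP[b0 _] ctl _ eps /andP[e2 e3].
have amax : alpha <= Num.max alpha beta by rewrite le_max lexx.
have bmax : beta <= Num.max alpha beta by rewrite le_max lexx orbT.
have ale : 2 * alpha < eps < 1 / 3 by rewrite e3 andbT; lra.
have ble : 2 * beta < eps < 1 / 3 by rewrite e3 andbT; lra.
have e0 : 0 < eps by lra.
have c6 : 6 <= 6 + 2 / eps by rewrite lerDl divr_ge0// ltW.
have c0 : 0 < 6 + 2 / eps by lra.
have i0 : 0 <= eps^-1 by rewrite invr_ge0 ltW.
split; first by lra.
  split; rewrite mulrC ler_pdivrMr//.
    have := FDP_minus_le a0 b0 ble ctl; nra.
  have := FNP_minus_le a0 b0 ble ctl; nra.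
split; rewrite mulrC ler_pdivrMr//.
  have := FNP_plus_le a0 b0 ale ctl; nra.
have := FDP_plus_le a0 b0 ale ctl; nra.
Qed.
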